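(* Let $\mathcal H_1$ and $\mathcal H_2$ be separable continuous fields of Hilbert spaces on a topological space $X$, and let $T$ be a $Q$-map from $\mathcal H_1$ to $\mathcal H_2$ such that $T(x)$ is one-one with dense range for every $x\in X$. Then $\mathcal H_1$ and $\mathcal H_2$ are isomorphic (as continuous fields of Hilbert spaces).
   Context: A continuous field of Hilbert spaces $\mathcal H$ on $X$ (in the sense of Dixmier-Douady) consists of Hilbert spaces $\mathcal H(x)$, $x\in X$, and a linear space $\Gamma$ of vector fields $e\in\prod_x\mathcal H(x)$ (called the sections, or continuous sections) such that $\{e(x):e\in\Gamma\}$ is dense in (equivalently, equal to) $\mathcal H(x)$ for all $x$, $x\mapsto\|e(x)\|$ is continuous for $e\in\Gamma$, and any vector field that can be locally uniformly approximated by elements of $\Gamma$ near each point of $X$ belongs to $\Gamma$. $\mathcal H$ is separable if there is a sequence of sections $e_1,e_2,\dots$ such that $\{e_n(x)\}$ is total in $\mathcal H(x)$ for every $x\in X$. An isomorphism of $\mathcal H_1$ and $\mathcal H_2$ is a family of unitaries $U(x):\mathcal H_1(x)\to\mathcal H_2(x)$ carrying the sections of $\mathcal H_1$ onto the sections of $\mathcal H_2$. A $Q$-map from $\mathcal H_1$ to $\mathcal H_2$ is a function $T$ on $X$ with $T(x)\in B(\mathcal H_1(x),\mathcal H_2(x))$ for all $x$, which is locally bounded (i.e. $x\mapsto\|T(x)\|$ is locally bounded) and such that for all sections $e_1$ of $\mathcal H_1$ and $e_2$ of $\mathcal H_2$ the function $x\mapsto (T(x)e_1(x),e_2(x))$ is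 continuous. *)

(* Defs.v *)
From HB Require Import structures.
From mathcomp Require Import all_boot all_order all_algebra complex.
From mathcomp Require Import all_classical all_reals all_analysis.

Set Implicit Arguments.
Unset Strict Implicit.
Unset Printing Implicit Defensive.

Import Order.TTheory GRing.Theory Num.Theory.
Import numFieldNormedType.Exports.

Local Open Scope classical_set_scope.
Local Open Scope complex_scope.
Local Open Scope ring_scope.

(* The inner product is linear in its first argument and conjugate-linear in
   its second one. *)
Record hilbertSpace (R : realType) := HilbertSpace {
  hilbert_sort :> completeNormedModType R[i] ;
  hdot : {dot hilbert_sort for Num.conj} ;
  hdotE : forall v : hilbert_sort, hdot v v = `|v| ^+ 2 }.

Arguments hdot {R} h.

Section Operators.
Variables (R : realType) (V W : hilbertSpace R).

Definition bounded_operator (f : {linear V -> W}) : Prop :=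
  [bounded f v | v in [set v : V | `|v| <= 1]].

(* Norms take their values in R[i], where they are real, hence the real part.
   The supremum is only meaningful when f is bounded. *)
Definition opnorm (f : {linear V -> W}) : R :=
  sup [set complex.Re `|f v| | v in [set v : V | `|v| <= 1]].

Definition unitary_operator (f : {linear V -> W}) : Prop :=
  (forall u v, hdot W (f u) (f v) = hdot V u v) /\ range f = [set: W].

Definition lspan (A : set V) : set V :=
  [set v | exists n (c : 'I_n -> R[i]) (w : 'I_n -> V),
    (forall i, A (w i)) /\ v = \sum_(i < n) c i *: w i].

Definition total_set (A : set V) : Prop := dense (lspan A).

End Operators.

(* In csection_local, a positive eps : R[i] is automatically real. *)
Record continuousField (R : realType) (X : topologicalType) :=
  ContinuousField {
    fiber :> X -> hilbertSpace R ;
    csection : set (forall x, fiber x) ;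
    csection0 : csection (fun x => 0) ;
    csectionD : forall e f, csection e -> csection f ->
      csection (fun x => e x + f x) ;
    csectionZ : forall (a : R[i]) e, csection e ->
      csection (fun x => a *: e x) ;
    csection_dense : forall x, dense [set e x | e in csection] ;
    csection_norm_continuous : forall e, csection e ->
      continuous (fun x => `|e x| : R[i]^o) ;
    csection_local : forall e : (forall x, fiber x),
      (forall (x0 : X) (eps : R[i]), 0 < eps ->
        exists2 f, csection f & \forall x \near x0, `|e x - f x| <= eps) ->
      csection e }.

Arguments csection {R X} c.

Section Fields.
Variables (R : realType) (X : topologicalType).
Implicit Types H : continuousField R X.

Definition separable_field H : Prop :=
  exists e : nat -> forall x, H x,
    (forall n, csection H (e n)) /\
    (forall x, total_set [set e n x | n in [set: nat]]).

Definition isomorphic_fields H1 H2 : Prop :=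
  exists U : forall x, {linear H1 x -> H2 x},
    (forall x, unitary_operator (U x)) /\
    [set (fun x => U x (e x)) | e in csection H1] = csection H2.

Definition Qmap H1 H2 (T : forall x, {linear H1 x -> H2 x}) : Prop :=
  [/\ forall x, bounded_operator (T x),
      [locally [bounded opnorm (T x) | x in [set: X]]] &
      forall e1 e2, csection H1 e1 -> csection H2 e2 ->
        continuous (fun x => hdot (H2 x) (T x (e1 x)) (e2 x) : R[i]^o)].

End Fields.

(* Main.v *)
Require Import Defs.
From HB Require Import structures.
From mathcomp Require Import all_boot all_order all_algebra complex.
From mathcomp Require Import all_classical all_reals all_analysis.
From mathcomp Require Import ring lra zify.

Import Order.TTheory GRing.Theory Num.Theory.
Import numFieldNormedType.Exports.

Set Implicit Arguments.
Unset Strict Implicit.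
Unset Printing Implicit Defensive.

Local Open Scope classical_set_scope.
Local Open Scope ring_scope.

(** The operator T cannot be polar-decomposed over X directly: it is only weakly
    continuous, so neither T nor its adjoint need send sections to sections.
    The remedy is to compress T by separating sequences of sections e_n of H1
    and f_n of H2, all of norm at most 1.  The vector fields

      h_m = sum_n 2^-(n+1) (f_m, T e_n) e_n

    are sections of H1, since their coefficients are continuous and the series
    converges locally uniformly.  With g_m = h_m / (1 + |h_m|) the operators

      B v = sum_m 2^-(m+1) (v, g_m) f_m,   B' w = sum_m 2^-(m+1) (w, f_m) g_m

    are adjoint contractions, and both preserve sections.  If D is the positive
    operator v |-> sum_n 2^-(n+1) (v, e_n) e_n, then B = E T D for a similar
    weighted sum E over the f_m, so B is injective because T is, and B' is
    injective because T has dense range (smoothing_inj, smoothing_adjoint_inj).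

    The pair (B, B') can be polar-decomposed (polar_isomorphism).  The modulus
    S = (B' B)^(1/2) is a uniform limit of polynomials in 1 - B' B, at a rate
    that does not depend on the point of X, so S preserves sections.
    Injectivity makes the ranges of S and B dense in every fibre
    (adjoint_dense), and |S u| = |B u|, so S u |-> B u extends to a unitary U
    (unitary_extension).  Near a point, a section of H1 is uniformly close to
    some S s with s a section, and its image under U is then equally close to
    the section B s; the same argument run backwards treats sections of H2. *)

Local Notation "''[' u , v ]" := (hdot _ u v) : ring_scope.

(** * Real-valued norms and inner products *)

Section HilbertAlgebra.
Variables (R : realType) (V : hilbertSpace R).
Implicit Types (u v w : V) (a : R[i]).

(** Norms take their values in R[i], which is only partially ordered; cabs and nrm
    are the same quantities as elements of R. *)
Definition cabs a : R := complex.Re `|a|.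
Definition nrm v : R := complex.Re `|v|.

Lemma ReC (z : R[i]) : 0 <= z -> z = (complex.Re z)%:C%C.
Proof. by move=> z0; rewrite RRe_real// ger0_real. Qed.

Lemma cabsE a : `|a| = (cabs a)%:C%C.
Proof. by apply: ReC; exact: normr_ge0. Qed.
Lemma nrmE v : `|v| = (nrm v)%:C%C.
Proof. by apply: ReC; exact: normr_ge0. Qed.

Lemma cabs_ge0 a : 0 <= cabs a. Proof. by rewrite -ler0c -cabsE normr_ge0. Qed.
Lemma nrm_ge0 v : 0 <= nrm v. Proof. by rewrite -ler0c -nrmE normr_ge0. Qed.
Lemma cabsM a b : cabs (a * b) = cabs a * cabs b.
Proof. by apply: complexI; rewrite rmorphM -!cabsE normrM. Qed.
Lemma cabsD a b : cabs (a + b) <= cabs a + cabs b.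
Proof. by rewrite -lecR rmorphD -!cabsE ler_normD. Qed.
Lemma cabsN a : cabs (- a) = cabs a.
Proof. by rewrite /cabs normrN. Qed.
Lemma cabs_conj a : cabs a^* = cabs a.
Proof. by rewrite /cabs norm_conjC. Qed.
Lemma cabs_eq0 a : cabs a <= 0 -> a = 0.
Proof.
move=> a0; apply/eqP; rewrite -normr_eq0 cabsE.
by rewrite (_ : cabs a = 0)//; apply/eqP; rewrite eq_le a0 cabs_ge0.
Qed.
Lemma cabsR (r : R) : cabs r%:C%C = `|r|.
Proof.
by apply: complexI; rewrite -[LHS]cabsE normc_def/= expr0n addr0 sqrtr_sqr.
Qed.
Lemma nrmZ a v : nrm (a *: v) = cabs a * nrm v.
Proof. by apply: complexI; rewrite rmorphM/= -!nrmE -cabsE normrZ. Qed.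
Lemma nrmD u v : nrm (u + v) <= nrm u + nrm v.
Proof. by rewrite -lecR rmorphD/= -!nrmE ler_normD. Qed.
Lemma nrmN v : nrm (- v) = nrm v.
Proof. by rewrite /nrm normrN. Qed.
Lemma nrmB u v : nrm (u - v) <= nrm u + nrm v.
Proof. by rewrite -(nrmN v) nrmD. Qed.
Lemma nrm_distC u v : nrm (u - v) = nrm (v - u).
Proof. by rewrite /nrm distrC. Qed.
Lemma nrm0 : nrm 0 = 0. Proof. by rewrite /nrm normr0. Qed.
Lemma nrm_eq0 v : nrm v <= 0 -> v = 0.
Proof.
move=> v0; apply/eqP; rewrite -normr_eq0 nrmE.
by rewrite (_ : nrm v = 0)//; apply/eqP; rewrite eq_le v0 nrm_ge0.
Qed.
Lemma nrm_tri u v w : nrm (u - w) <= nrm (u - v) + nrm (v - w).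
Proof. by rewrite (le_trans _ (nrmD _ _))// addrA subrK. Qed.

Lemma dotDl u v w : '[u + v, w] = '[u, w] + '[v, w].
Proof. exact: linearDl. Qed.
Lemma dotBl u v w : '[u - v, w] = '[u, w] - '[v, w].
Proof. exact: linearBl. Qed.
Lemma dotZl a u w : '[a *: u, w] = a * '[u, w].
Proof. exact: linearZl_LR. Qed.
Lemma dot0l w : '[0, w] = 0.
Proof. exact: linear0l. Qed.
Lemma dotC u v : '[u, v] = '[v, u]^*.
Proof. by rewrite hermC mul1r. Qed.
Lemma dotDr u v w : '[u, v + w] = '[u, v] + '[u, w].
Proof. exact: linearDr. Qed.
Lemma dotBr u v w : '[u, v - w] = '[u, v] - '[u, w].
Proof. exact: linearBr. Qed.
Lemma dotZr a u w : '[u, a *: w] = a^* * '[u, w].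
Proof. exact: linearZr_LR. Qed.
Lemma dot0r w : '[w, 0] = 0.
Proof. exact: linear0r. Qed.

Lemma nrm2 v : '[v, v] = (nrm v ^+ 2)%:C%C.
Proof. by rewrite hdotE rmorphXn/= -nrmE. Qed.

Lemma dot_eq0 v : '[v, v] = 0 -> v = 0.
Proof.
rewrite nrm2 => /complexI/eqP; rewrite sqrf_eq0 => /eqP h.
by apply: nrm_eq0; rewrite h.
Qed.

Lemma nrmB2 u v :
  nrm (u - v) ^+ 2 = nrm u ^+ 2 + nrm v ^+ 2 - 2 * complex.Re '[u, v].
Proof.
apply: complexI; rewrite -nrm2 dotBl !dotBr (dotC v u) !nrm2.
case: '[u, v] => x y; apply/eqP; rewrite eq_complex /=; apply/andP.
by split; apply/eqP; simpc; rewrite /=; ring.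
Qed.

Lemma CS u v : cabs '[u, v] <= nrm u * nrm v.
Proof.
have [->|v0] := eqVneq v 0.
  by rewrite dot0r nrm0 mulr0 /cabs normr0.
have v_gt0 : 0 < nrm v.
  rewrite lt_neqAle nrm_ge0 andbT; apply: contra_neq v0 => v0.
  by apply: nrm_eq0; rewrite -v0.
pose a := '[u, v] / '[v, v].
have : 0 <= complex.Re '[u - a *: v, u - a *: v] by rewrite nrm2 sqr_ge0.
have -> : '[u - a *: v, u - a *: v] = '[u, u] - '[u, v] * '[u, v]^* / '[v, v].
  rewrite dotBl !dotBr !dotZl !dotZr (dotC v u) /a rmorphM fmorphV/= -(dotC v v).
  by field; apply: contra_neq v0 => /dot_eq0.
rewrite -normCK cabsE !nrm2 -rmorphXn -fmorphV -rmorphM -rmorphB/= subr_ge0.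
rewrite ler_pdivrMr ?exprn_gt0// -exprMn ler_sqr// nnegrE ?cabs_ge0//.
by rewrite mulr_ge0// nrm_ge0.
Qed.
End HilbertAlgebra.

(** * Limits with explicit rates *)

Section Limits.
Variables (R : realType) (V : hilbertSpace R).
Implicit Types (u : nat -> V) (d : nat -> R).

Lemma le_vanishing d (x K : R) :
  d @ \oo --> 0 -> (forall n, x <= K * d n) -> x <= 0.
Proof.
move=> d0 xd; have Kd : (fun n => K * d n) @ \oo --> 0.
  by rewrite -[X in _ --> X](mulr0 K); apply: cvgMr.
by apply: (cvgr_to_ge Kd); apply: nearW => n; exact: xd.
Qed.

Lemma hilbert_complete u :
  (forall eps : R, 0 < eps ->
     exists N, forall m n, (N <= m)%N -> (N <= n)%N -> nrm (u m - u n) < eps) ->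
  forall eps : R, 0 < eps -> \forall n \near \oo, nrm (lim (u @ \oo) - u n) < eps.
Proof.
move=> uC.
have /cauchy_cvg/cvgrPdist_lt ucvg : cauchy (u @ \oo).
  apply: cauchy_exP => e e0; have er := ReC (ltW e0).
  move: er e0; set r := complex.Re e => ->; rewrite (_ : 0 = 0%:C%C)// ltcR => r0.
  have [N uN] := uC _ r0; exists (u N); exists N => // n /= Nn.
  by rewrite /= -ball_normE /ball_/= nrmE ltcR; apply: uN.
move=> eps eps0; have := ucvg eps%:C%C; rewrite (_ : 0 = 0%:C%C)// ltcR => /(_ eps0).
by apply: filterS => n /=; rewrite nrmE ltcR.
Qed.

(** Successive increments are dominated by those of - K d, so the tails telescope.
    Since d is the same at every point of X, this gives convergence that is
    uniform in x, both for the diagonal sums (d n = 2^-n) and for the square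
    root iteration (d = slack). *)
Lemma telescoping_limit u d (K : R) : 0 <= K -> d @ \oo --> 0 ->
  (forall n, nrm (u n.+1 - u n) <= K * (d n - d n.+1)) ->
  forall n, nrm (lim (u @ \oo) - u n) <= K * d n.
Proof.
move=> K0 d0 ud.
have hk n k : nrm (u (n + k)%N - u n) <= K * (d n - d (n + k)%N).
  elim: k => [|k IH]; first by rewrite addn0 !subrr mulr0 nrm0.
  rewrite addnS (le_trans (nrm_tri _ (u (n + k)%N) _))//.
  by have := ud (n + k)%N; lra.
have hm m n : (m <= n)%N -> nrm (u n - u m) <= K * (d m - d n).
  by move=> mn; have := hk m (n - m)%N; rewrite subnKC.
have Kd : (fun n => K * d n) @ \oo --> 0.
  by rewrite -[X in _ --> X](mulr0 K); apply: cvgMr.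
have Kd0 n : 0 <= K * d n.
  apply: (cvgr_to_le Kd); exists n => // m /= nm.
  by have := hm _ _ nm; have := nrm_ge0 (u m - u n); lra.
have uC eps : 0 < eps ->
    exists N, forall m n, (N <= m)%N -> (N <= n)%N -> nrm (u m - u n) < eps.
  move=> eps0; have [N _ dN] : \forall n \near \oo, K * d n < eps.
    exact: (cvgr_lt _ Kd).
  exists N => m n Nm Nn; wlog mn : m n Nm Nn / (m <= n)%N => [wl|].
    case: (leP m n) => [|/ltW] mn; first exact: wl.
    by rewrite nrm_distC; apply: wl.
  rewrite nrm_distC (le_lt_trans (hm _ _ mn))//.
  by have := dN m Nm; have := Kd0 n; rewrite /= ; lra.
move=> n; apply/ler_addgt0Pl => e e0.
have [N _ hN] := hilbert_complete uC e0.
have := hN (maxn N n) (leq_maxl _ _); rewrite /= => h1.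
rewrite (le_trans (nrm_tri _ (u (maxn N n)) _))//.
have := hm _ _ (leq_maxr N n); have := Kd0 (maxn N n).
lra.
Qed.

End Limits.

(** * Adjoint pairs and diagonal sums *)

Section Adjoints.
Variables (R : realType) (V W : hilbertSpace R).
Implicit Types (M : V -> W) (N : W -> V).

(** A relation between plain functions: it forces both of them to be linear
    (adjoint_linear). *)
Definition adjoint M N := forall v w, '[M v, w] = '[v, N w].

Definition contractive M := forall v, nrm (M v) <= nrm v.

Definition dense_range M :=
  forall (w : W) (eps : R), 0 < eps -> exists v, nrm (w - M v) < eps.

End Adjoints.

Lemma dot_inj (R : realType) (V : hilbertSpace R) (x y : V) :
  (forall w, '[x, w] = '[y, w]) -> x = y.
Proof.
move=> xy; apply/eqP; rewrite -subr_eq0; apply/eqP/dot_eq0.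
by rewrite dotBl xy subrr.
Qed.

Section AdjointLinear.
Variables (R : realType) (V W : hilbertSpace R) (M : V -> W) (N : W -> V).

Lemma adjointC : adjoint M N -> adjoint N M.
Proof. by move=> MN w v; rewrite dotC -MN -dotC. Qed.

Lemma adjoint_linear : adjoint M N -> linear M.
Proof.
by move=> MN a u v; apply: dot_inj => w; rewrite MN !dotDl !dotZl !MN.
Qed.

Lemma adjoint0 : adjoint M N -> M 0 = 0.
Proof. by move=> MN; apply: dot_inj => w; rewrite MN !dot0l. Qed.

Lemma adjointD u v : adjoint M N -> M (u + v) = M u + M v.
Proof. by move=> MN; apply: dot_inj => w; rewrite MN !dotDl !MN. Qed.

Lemma adjointB u v : adjoint M N -> M (u - v) = M u - M v.
Proof. by move=> MN; apply: dot_inj => w; rewrite MN !dotBl !MN. Qed.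

End AdjointLinear.

Section AdjointTheory.
Variables (R : realType) (V W : hilbertSpace R).
Implicit Types (M : V -> W) (N : W -> V).

(** The cross term 2 Re (v, M N v) is 2 |N v|^2, while |M N v| <= |N v|. *)
Lemma defect_norm M N v : adjoint N M -> contractive M ->
  nrm (v - M (N v)) ^+ 2 <= nrm v ^+ 2 - nrm (N v) ^+ 2.
Proof.
move=> NM Mc; rewrite nrmB2 -NM nrm2/=.
have : nrm (M (N v)) ^+ 2 <= nrm (N v) ^+ 2.
  by rewrite lerXn2r// nnegrE nrm_ge0.
lra.
Qed.

(** Put Q = 1 - M N.  The norms |Q^k w| decrease, and since Q is self-adjoint,
    (Q^2m w, Q^2n w) = |Q^(m+n) w|^2; hence the sequence Q^2k w is Cauchy.  By
    defect_norm, N kills its limit, which is therefore 0.  As w - Q^k w always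
    lies in the range of M, that range comes arbitrarily close to w. *)
Lemma adjoint_dense M N : adjoint M N -> contractive M -> contractive N ->
  (forall w, N w = 0 -> w = 0) -> dense_range M.
Proof.
move=> MN Mc Nc N0 w eps eps0; have NM := adjointC MN.
pose Q x := x - M (N x); pose z k := iter k Q w.
have QQ : adjoint Q Q by move=> x y; rewrite /Q dotBl dotBr MN NM.
have zS i j k : '[z (i + k)%N, z j] = '[z i, z (j + k)%N].
  elim: k i j => [|k IH] i j; first by rewrite !addn0.
  by rewrite addnS -addSn IH /z iterS QQ -iterS -addnS.
pose b k := nrm (z k) ^+ 2.
have bS k : b k.+1 <= b k - nrm (N (z k)) ^+ 2 by exact: defect_norm.
have b_ninc : nonincreasing_seq b.
  apply/nonincreasing_seqP => k; rewrite (le_trans (bS k))// gerBl//.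
  exact: sqr_ge0.
have [l /cvgrPdist_lt bl] : exists l : R, b k @[k --> \oo] --> l.
  apply/cvg_ex; apply: nonincreasing_is_cvgn => //.
  by exists 0 => _ [k _ <-]; exact: sqr_ge0.
have bnear (e : R) : 0 < e -> exists K, forall k, (K <= k)%N -> `|l - b k| < e.
  by move=> e0; have [K _ hK] := bl _ e0; exists K.
have zC (e : R) : 0 < e -> exists K, forall m n, (K <= m)%N -> (K <= n)%N ->
    nrm (z m.*2 - z n.*2) < e.
  (* |z 2m - z 2n|^2 = b 2m + b 2n - 2 b (m + n), and the error in b counts
     four times. *)
  move=> e0; have [|K hK] := bnear (e ^+ 2 / 4); first by nra.
  exists K => m n Km Kn; wlog mn : m n Km Kn / (m <= n)%N => [wl|].
    case: (leP m n) => [|/ltW] mn; first exact: wl.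
    by rewrite nrm_distC; apply: wl.
  rewrite -(@ltr_pXn2r _ 2)// ?nnegrE ?nrm_ge0 ?ltW// nrmB2.
  have -> : '[z m.*2, z n.*2] = '[z (m + n)%N, z (m + n)%N].
    rewrite (_ : (m + n = m.*2 + (n - m))%N) 1?zS; last by lia.
    by congr ('[z _, z _]); lia.
  rewrite nrm2/= -!/(b _).
  have K2 i : (K <= i)%N -> (K <= i.*2)%N by lia.
  have := hK _ (K2 _ Km); have := hK _ (K2 _ Kn).
  have := hK _ (leq_trans Km (leq_addr n m)).
  by rewrite !ltr_norml; lra.
have zlim (e : R) : 0 < e ->
    \forall k \near \oo, nrm (lim (z k.*2 @[k --> \oo]) - z k.*2) < e.
  exact: hilbert_complete.
set L := lim _ in zlim.
have NL : N L = 0.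
  apply/nrm_eq0/ler_addgt0Pl => e e0; rewrite addr0.
  have e2 : 0 < e / 2 by lra.
  have [K1 _ hK1] := zlim _ e2.
  have [|K2 hK2] := bnear ((e / 2) ^+ 2 / 2); first by nra.
  pose k := maxn K1 K2; have /= zk := hK1 k (leq_maxl _ _).
  have Kk : (K2 <= k.*2)%N by have := leq_maxr K1 K2; rewrite -/k; lia.
  have Nz : nrm (N (z k.*2)) < e / 2.
    rewrite -(@ltr_pXn2r _ 2)// ?nnegrE ?nrm_ge0 ?ltW//.
    have := bS k.*2; have := hK2 _ Kk; have := hK2 _ (leqW Kk).
    by rewrite !ltr_norml; lra.
  have := Nc (L - z k.*2); rewrite (adjointB _ _ NM) => h.
  rewrite -[N L](subrK (N (z k.*2))).
  by rewrite (le_trans (nrmD _ _))//; lra.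
have {NL} L0 := N0 _ NL.
have range k : exists v, w - z k = M v.
  elim: k => [|k [v wv]].
    by exists 0; rewrite subrr (adjoint0 MN).
  exists (v + N (z k)); rewrite (adjointD _ _ MN) -wv.
  by rewrite /= /Q opprB addrCA addrC.
have [k _ /(_ _ (leqnn k))] := zlim _ eps0; rewrite L0 sub0r nrmN => zk.
by have [v wv] := range k.*2; exists v; rewrite -wv opprB addrC subrK.
Qed.

End AdjointTheory.

Section DiagonalSums.
Variables (R : realType) (V W : hilbertSpace R).
Implicit Types (c : nat -> V) (b : nat -> W).

(** The weights 2^-(i+1) have sum 1, so that a common bound on the products
    |c i| |b i| is a bound on the operator norm of the whole sum. *)
Definition psum c b n v : W :=
  \sum_(i < n) (2^-1 ^+ i.+1 * '[v, c i]) *: b i.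

Definition dsum c b v : W := lim (psum c b n v @[n --> \oo]).

Lemma half_vanishing : (fun n => 2^-1 ^+ n : R) @ \oo --> 0.
Proof. by apply: cvg_expr; rewrite ger0_norm ?invr_ge0 ?ler0n//; lra. Qed.

Lemma cabs_half n : cabs (2^-1 ^+ n : R[i]) = 2^-1 ^+ n.
Proof.
rewrite (_ : 2^-1 ^+ n = (2^-1 ^+ n)%:C%C); last first.
  by rewrite rmorphXn fmorphV rmorph_nat.
by rewrite cabsR ger0_norm// exprn_ge0// invr_ge0 ler0n.
Qed.

Lemma dsum_approx c b (C : R) v : (forall i, nrm (c i) * nrm (b i) <= C) ->
  forall n, nrm (dsum c b v - psum c b n v) <= (C * nrm v) * 2^-1 ^+ n.
Proof.
move=> cb; have C0 : 0 <= C.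
  by rewrite (le_trans _ (cb 0%N))// mulr_ge0// nrm_ge0.
apply: telescoping_limit; first by rewrite mulr_ge0 ?nrm_ge0.
  exact: half_vanishing.
move=> n; rewrite /psum big_ord_recr/= addrAC subrr add0r nrmZ cabsM cabs_half.
have -> : 2^-1 ^+ n - 2^-1 ^+ n.+1 = 2^-1 ^+ n.+1 :> R by rewrite exprS; lra.
rewrite -mulrA mulrC ler_wpM2r ?exprn_ge0 ?invr_ge0 ?ler0n//.
rewrite (le_trans (ler_wpM2r (nrm_ge0 _) (CS v (c n))))// -mulrA mulrC.
by rewrite ler_wpM2r ?nrm_ge0.
Qed.

Lemma dsum_bound c b (C : R) v : (forall i, nrm (c i) * nrm (b i) <= C) ->
  nrm (dsum c b v) <= C * nrm v.
Proof.
by move=> cb; have := dsum_approx v cb 0; rewrite /psum big_ord0 subr0 expr0 mulr1.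
Qed.

Lemma dot_psum c b n v w :
  '[psum c b n v, w] = \sum_(i < n) 2^-1 ^+ i.+1 * ('[v, c i] * '[b i, w]).
Proof.
rewrite /psum; elim: n => [|n IH]; first by rewrite !big_ord0 dot0l.
by rewrite !big_ord_recr/= dotDl IH dotZl mulrA.
Qed.

Lemma dot_dsum_approx c b (C : R) v w : (forall i, nrm (c i) * nrm (b i) <= C) ->
  forall n, cabs ('[dsum c b v, w] -
      \sum_(i < n) 2^-1 ^+ i.+1 * ('[v, c i] * '[b i, w])) <=
    (C * nrm v * nrm w) * 2^-1 ^+ n.
Proof.
move=> cb n; rewrite -dot_psum -dotBl (le_trans (CS _ _))// mulrAC.
by rewrite ler_wpM2r ?nrm_ge0//; apply: dsum_approx.
Qed.

(** A term with nonnegative companions is at most every later partial sum, and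
    these tend to 0. *)
Lemma dsum_pos c b (C : R) v w : (forall i, nrm (c i) * nrm (b i) <= C) ->
  (forall i, 0 <= '[v, c i] * '[b i, w]) -> '[dsum c b v, w] = 0 ->
  forall i, '[v, c i] * '[b i, w] = 0.
Proof.
move=> cb pos dv0 i; set a := '[v, c i] * _.
have h0 j : 0 <= 2^-1 ^+ j.+1 * ('[v, c j] * '[b j, w]).
  by rewrite mulr_ge0// exprn_ge0// invr_ge0 ler0n.
suff : 2^-1 ^+ i.+1 * a = 0.
  by move/eqP; rewrite mulf_eq0 expf_eq0 invr_eq0 pnatr_eq0/= => /eqP.
apply: cabs_eq0.
apply: (le_vanishing (d := fun n => 2^-1 ^+ (n + i.+1)) (K := C * nrm v * nrm w)).
  by rewrite cvg_shiftn; apply: half_vanishing.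
move=> n; have := dot_dsum_approx v w cb (n + i.+1).
rewrite dv0 sub0r cabsN; apply: le_trans.
rewrite -lecR -!cabsE !ger0_norm//; last by rewrite sumr_ge0.
have lt_i : (i < n + i.+1)%N by rewrite addnS ltnS leq_addl.
by rewrite (bigD1 (Ordinal lt_i))//= lerDl sumr_ge0.
Qed.

End DiagonalSums.

Section DiagonalSumTheory.
Variables (R : realType) (V W : hilbertSpace R).
Variables (c : nat -> V) (b : nat -> W) (C : R).
Hypothesis cb : forall i, nrm (c i) * nrm (b i) <= C.

(** Exchanging c and b conjugates and transposes each rank-one term. *)
Lemma dsum_adjoint : adjoint (dsum c b) (dsum b c).
Proof.
move=> v w; apply/eqP; rewrite -subr_eq0; apply/eqP/cabs_eq0.
have bc i : nrm (b i) * nrm (c i) <= C by rewrite mulrC.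
apply: (le_vanishing (d := fun n => 2^-1 ^+ n) (K := 2 * (C * nrm v * nrm w))).
  exact: half_vanishing.
move=> n.
have h1 := dot_dsum_approx v w cb n.
have h2 := dot_dsum_approx w v bc n.
have h3 : cabs ('[v, dsum b c w] -
    \sum_(i < n) 2^-1 ^+ i.+1 * ('[v, c i] * '[b i, w])) <=
    (C * nrm v * nrm w) * 2^-1 ^+ n.
  rewrite -(mulrA C) (mulrC (nrm v)) mulrA.
  apply: le_trans h2; rewrite -cabs_conj rmorphB/= -dotC rmorph_sum/=.
  rewrite le_eqVlt; apply/orP; left; apply/eqP; congr (cabs (_ - _)).
  apply: eq_bigr => i _; rewrite !rmorphM rmorphXn fmorphV rmorph_nat/= -!dotC.
  by congr (_ * _); exact: mulrC.
have -> : '[dsum c b v, w] - '[v, dsum b c w] =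
  ('[dsum c b v, w] - \sum_(i < n) 2^-1 ^+ i.+1 * ('[v, c i] * '[b i, w])) -
  ('[v, dsum b c w] - \sum_(i < n) 2^-1 ^+ i.+1 * ('[v, c i] * '[b i, w])).
  by ring.
rewrite (le_trans (cabsD _ _))// cabsN.
by rewrite -mulrA mulr_natl mulr2n lerD.
Qed.

Lemma dsum_map (U : hilbertSpace R) (T : {linear W -> U}) (K : R) v : 0 <= K ->
  (forall w, nrm (T w) <= K * nrm w) ->
  T (dsum c b v) = dsum c (fun i => T (b i)) v.
Proof.
move=> K0 TK; apply/eqP; rewrite -subr_eq0; apply/eqP/nrm_eq0.
have cTb i : nrm (c i) * nrm (T (b i)) <= K * C.
  have := TK (b i); have := cb i; have := nrm_ge0 (c i); nra.
apply: (le_vanishing (d := fun n => 2^-1 ^+ n) (K := 2 * (K * C * nrm v))).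
  exact: half_vanishing.
move=> n.
rewrite (le_trans (nrm_tri _ (T (psum c b n v)) _))// -linearB.
have -> : T (psum c b n v) = psum c (fun i => T (b i)) n v.
  by rewrite /psum linear_sum; apply: eq_bigr => i _; rewrite linearZ.
rewrite -!mulrA mulr_natl mulr2n lerD//.
  by rewrite (le_trans (TK _))// ler_wpM2l// mulrA dsum_approx.
by rewrite nrm_distC !mulrA; apply: dsum_approx.
Qed.

End DiagonalSumTheory.

(** * Square roots by iteration *)

Section SquareRoot.
Variables (R : realType) (V : hilbertSpace R) (Q : V -> V).

(** Error bound for root_iter: 1 - slack k is the k-th iterate in the scalar case
    Q = 1, where the solution is 1. *)
Fixpoint slack k : R := if k is k'.+1 then slack k' - slack k' ^+ 2 / 2 else 1.

(** Iterates towards a solution Y of Y = (Q + Y^2) / 2, which is the same as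
    (1 - Y)^2 = 1 - Q. *)
Fixpoint root_iter k v : V :=
  if k is k'.+1 then 2^-1 *: (Q v + root_iter k' (root_iter k' v)) else 0.

(** A self-adjoint square root of 1 - Q, when Q is a self-adjoint contraction. *)
Definition sqroot v : V := v - lim (root_iter k v @[k --> \oo]).

(** The bound 2 / (k + 2) reproduces itself, because t - t^2 / 2 is increasing on
    [0, 1] and (k + 1) (k + 3) <= (k + 2)^2. *)
Lemma slack_bounds k : 0 <= slack k <= 2 / k.+2%:R.
Proof.
elim: k => [|k /andP[s0 s2]]; first by rewrite /= ler01 divff ?lexx ?pnatr_eq0.
have k2 : 0 < k.+2%:R :> R by rewrite ltr0n.
have k3 : 0 < k.+3%:R :> R by rewrite ltr0n.
have e1 : 2 / k.+2%:R <= 1 :> R by rewrite ler_pdivrMr// mul1r ler_nat.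
have s1 := le_trans s2 e1.
rewrite /=; apply/andP; split.
  rewrite (_ : _ - _ = slack k * (1 - slack k / 2)); last by ring.
  by rewrite mulr_ge0//; lra.
set e := 2 / k.+2%:R in s2 e1 *.
apply: (@le_trans _ _ (e - e ^+ 2 / 2)).
  rewrite -subr_ge0 (_ : _ - _ = (e - slack k) * (1 - (e + slack k) / 2));
    last by ring.
  by rewrite mulr_ge0//; lra.
rewrite /e -subr_ge0.
have id3 (x : R) : 0 < x ->
    2 / (x + 1) - (2 / x - (2 / x) ^+ 2 / 2) = 2 / ((x + 1) * x ^+ 2).
  by move=> x0; field; rewrite !lt0r_neq0// addr_gt0.
rewrite -(natr1 k.+2) (id3 _ k2) natr1.
by rewrite divr_ge0// mulr_ge0// ?sqr_ge0// ltW.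
Qed.

Lemma slack_vanishing : slack @ \oo --> 0.
Proof.
apply: (@squeeze_cvgr _ _ _ _ (fun=> 0) (fun k => 2 * (k.+1%:R)^-1)).
- apply: nearW => k; have /andP[-> /le_trans->]// := slack_bounds k.
  by rewrite ler_pM2l// lef_pV2 ?posrE ?ltr0n// ler_nat.
- exact: cvg_cst.
- rewrite -[X in _ --> X](mulr0 2); apply: cvgMr; exact: cvg_harmonic.
Qed.

Hypothesis Qc : contractive Q.
Hypothesis QQ : adjoint Q Q.

Lemma slack01 k : 0 <= slack k <= 1.
Proof.
have /andP[-> /le_trans->]// := slack_bounds k.
by rewrite ler_pdivrMr ?ltr0n// mul1r ler_nat.
Qed.

Lemma root_iter_adjoint k : adjoint (root_iter k) (root_iter k).
Proof.
elim: k => [|k IH] v w /=; first by rewrite dot0l dot0r.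
rewrite dotZl dotZr dotDl dotDr QQ !IH; congr (_ * _).
by rewrite fmorphV rmorph_nat.
Qed.

Lemma root_iter_norm k v : nrm (root_iter k v) <= (1 - slack k) * nrm v.
Proof.
elim: k v => [|k IH] v /=; first by rewrite nrm0 subrr mul0r.
have -> : 2^-1 = 2^-1 ^+ 1 :> R[i] by [].
rewrite nrmZ cabs_half expr1.
have := nrmD (Q v) (root_iter k (root_iter k v)).
have := Qc v; have := IH v; have := IH (root_iter k v).
have := nrm_ge0 v; have /andP[] := slack01 k.
nra.
Qed.

(** The difference of two squares is split as Z^2 - Y^2 = Z (Z - Y) + (Z - Y) Y,
    so the norms satisfy the same recursion as the scalar iterates. *)
Lemma root_iter_step k v :
  nrm (root_iter k.+1 v - root_iter k v) <= nrm v * (slack k - slack k.+1).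
Proof.
elim: k v => [|k IH] v.
  have -> : root_iter 1 v - root_iter 0 v = 2^-1 ^+ 1 *: Q v.
    by rewrite /= addr0 subr0.
  rewrite nrmZ cabs_half /= expr1; have := Qc v; lra.
pose Y := root_iter k; pose Z := root_iter k.+1.
have -> : root_iter k.+2 v - root_iter k.+1 v =
    2^-1 ^+ 1 *: (Z (Z v - Y v) + (Z (Y v) - Y (Y v))).
  rewrite {1}/Z (adjointB _ _ (root_iter_adjoint k.+1)) -/Z addrA subrK.
  rewrite [X in X - _](_ : _ = 2^-1 ^+ 1 *: (Q v + Z (Z v)))//.
  rewrite [X in _ - X](_ : _ = 2^-1 ^+ 1 *: (Q v + Y (Y v)))//.
  by rewrite -scalerBr opprD addrACA subrr add0r.
rewrite nrmZ cabs_half expr1.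
have := nrmD (Z (Z v - Y v)) (Z (Y v) - Y (Y v)).
have := IH (Y v); rewrite -/Y -/Z.
have := root_iter_norm k v; rewrite -/Y.
have := root_iter_norm k.+1 (Z v - Y v); rewrite -/Z.
have := IH v; rewrite -/Y -/Z.
have := slack01 k; have := slack01 k.+1.
have : slack k.+1 - slack k.+2 =
    2^-1 * ((slack k - slack k.+1) * ((1 - slack k) + (1 - slack k.+1))).
  by rewrite /=; field.
have : 0 <= slack k - slack k.+1.
  by rewrite /= opprB addrC subrK divr_ge0// sqr_ge0.
have := nrm_ge0 v; set D := slack k - slack k.+1.
set a := nrm v; set bb := nrm _; set cc := nrm (Y v); set dd := nrm (Z (Y v) - _).
move=> a0 D0 -> /andP[r0 r1] /andP[s0 s1] bE ZE YE dE tri.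
have : (1 - slack k.+1) * bb <= (1 - slack k.+1) * (a * D) by apply: ler_wpM2l; lra.
have : cc * D <= (1 - slack k) * a * D by apply: ler_wpM2r.
by lra.
Qed.

Lemma sqroot_approx k v : nrm (v - sqroot v - root_iter k v) <= nrm v * slack k.
Proof.
rewrite /sqroot subKr; apply: telescoping_limit; first exact: nrm_ge0.
  exact: slack_vanishing.
by move=> n; exact: root_iter_step.
Qed.

Lemma sqroot_adjoint : adjoint sqroot sqroot.
Proof.
move=> v w; apply/eqP; rewrite -subr_eq0; apply/eqP/cabs_eq0.
apply: (le_vanishing (K := 2 * (nrm v * nrm w)) slack_vanishing) => k.
have -> : '[sqroot v, w] - '[v, sqroot w] =
    '[v, w - sqroot w - root_iter k w] - '[v - sqroot v - root_iter k v, w].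
  by rewrite !dotBl !dotBr root_iter_adjoint; ring.
rewrite (le_trans (cabsD _ _))// cabsN.
have := CS v (w - sqroot w - root_iter k w).
have := CS (v - sqroot v - root_iter k v) w.
have := sqroot_approx k v; have := sqroot_approx k w.
have := nrm_ge0 v; have := nrm_ge0 w.
set a := nrm _; set b := nrm _; set c := nrm (_ - _); set d := nrm (_ - _).
move=> a0 b0 cE dE.
have : d * a <= b * slack k * a by apply: ler_wpM2r.
have : b * c <= b * (a * slack k) by apply: ler_wpM2l.
by lra.
Qed.

Lemma sqroot_sqr v : sqroot (sqroot v) = v - Q v.
Proof.
pose L v := v - sqroot v.
have La k u : nrm (L u - root_iter k u) <= nrm u * slack k by exact: sqroot_approx.
have Lc u : nrm (L u) <= nrm u by have := La 0 u; rewrite /= subr0 mulr1.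
have LE : 2^-1 *: (Q v + L (L v)) = L v.
  apply/eqP; rewrite -subr_eq0; apply/eqP/nrm_eq0.
  apply: (le_vanishing (K := 2 * nrm v) slack_vanishing) => k.
  pose Y := root_iter k.
  have -> : 2^-1 *: (Q v + L (L v)) - L v =
     2^-1 ^+ 1 *: ((L (L v) - Y (L v)) + (Y (L v - Y v))) -
     (L v - root_iter k.+1 v).
    have -> : (L (L v) - Y (L v)) + Y (L v - Y v) = L (L v) - Y (Y v).
      by rewrite {2}/Y (adjointB _ _ (root_iter_adjoint k)) addrA subrK.
    rewrite [root_iter k.+1 v](_ : _ = 2^-1 ^+ 1 *: (Q v + Y (Y v)))//.
    have e (x y z t : V) : 2^-1 ^+ 1 *: (x - y) - (z - 2^-1 ^+ 1 *: (t + y)) =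
        2^-1 *: (t + x) - z.
      by rewrite opprB addrA -scalerDr [x - y + _]addrC addrACA subrr addr0.
    by rewrite e.
  rewrite (le_trans (nrmB _ _))// nrmZ cabs_half expr1.
  have := La k.+1 v; have := nrmD (L (L v) - Y (L v)) (Y (L v - Y v)).
  have := La k (L v); have := La k v; have := root_iter_norm k (L v - Y v).
  have := Lc v; have := nrm_ge0 v.
  have := nrm_ge0 (L v - Y v).
  have /andP[] := slack01 k.
  rewrite -/Y [slack k.+1]/=.
  set a := nrm v; set l := nrm (L v).
  set p := nrm (L v - Y v); set q := nrm (L (L v) - _).
  move=> s0 s1 p0 a0 la h1 h2 h3 h4 h5.
  have : l * slack k <= a * slack k by apply: ler_wpM2r.
  have : (1 - slack k) * p <= p by nra.
  have : a * (slack k - slack k ^+ 2 / 2) <= a * slack k.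
    by apply: ler_wpM2l => //; have := sqr_ge0 (slack k); lra.
  by lra.
have L2 : L (L v) = 2 *: L v - Q v.
  rewrite -[X in 2 *: X]LE scalerA divff ?scale1r ?pnatr_eq0//.
  by rewrite addrC addKr.
have SE u : sqroot u = u - L u by rewrite /L subKr.
rewrite [sqroot v in LHS]SE (adjointB _ _ sqroot_adjoint) !SE L2.
rewrite scaler_nat mulr2n; move: (L v) (Q v) => y z.
by rewrite opprB [y + y - z]addrAC addrK addrA subrK.
Qed.

End SquareRoot.

(** * Unitary extension *)

(** The inner product is a continuous expression in norms.  This is used twice: an
    isometry is unitary, and the inner product of two sections is continuous. *)
Lemma polarization (R : realType) (V : hilbertSpace R) (u v : V) :
  '[u, v] = 2^-1 * ((`|u + v| ^+ 2 - `|u| ^+ 2 - `|v| ^+ 2) +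
     'i * (`|u + 'i *: v| ^+ 2 - `|u| ^+ 2 - `|v| ^+ 2)).
Proof.
rewrite -!hdotE !dotDl !dotDr !dotZl !dotZr conjCi.
have i2 : 'i * 'i = -1 :> R[i] by rewrite -expr2 sqrCi.
have -> : '[v, v] = - ('i * 'i) * '[v, v] by rewrite i2 opprK mul1r.
have -> : 'i * ('[u, u] + - 'i * '[u, v] +
     ('i * '[v, u] + 'i * (- 'i * (- ('i * 'i) * '[v, v]))) -
     '[u, u] - - ('i * 'i) * '[v, v]) =
     - ('i * 'i) * '[u, v] + ('i * 'i) * '[v, u] :> R[i].
  by ring: i2.
by rewrite i2; field.
Qed.

Section UnitaryExtension.
Variables (R : realType) (Z V W : hilbertSpace R) (S : Z -> V) (B : Z -> W).

(** The closure of the relation between S u and B u, in V times W. *)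
Definition approx_graph (v : V) (w : W) := forall eps : R, 0 < eps ->
  exists u, nrm (v - S u) < eps /\ nrm (w - B u) < eps.

Hypothesis Slin : linear S.
Hypothesis Blin : linear B.
Hypothesis SB : forall u, nrm (S u) = nrm (B u).

Let SBB u v : nrm (S u - S v) = nrm (B u - B v).
Proof.
have e (W' : hilbertSpace R) (F : Z -> W') : linear F -> F u - F v = F (u - v).
  move=> Flin; have := Flin (-1) v u; rewrite !scaleN1r addrC => <-.
  by rewrite addrC.
by rewrite (e _ _ Slin) (e _ _ Blin).
Qed.

(** If S u_n tends to v, then B u_n is Cauchy, because |B u - B u'| = |S u - S u'|. *)
Lemma approx_graphP v : dense_range S -> exists w, approx_graph v w.
Proof.
move=> Sd; have /choice[u uv] : forall n : nat, exists u, nrm (v - S u) < 2^-1 ^+ n.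
  by move=> n; apply: Sd; rewrite exprn_gt0// invr_gt0.
have small (eps : R) : 0 < eps ->
    exists N, forall n, (N <= n)%N -> nrm (v - S (u n)) < eps.
  move=> eps0; have [N _ hN] : \forall n \near \oo, 2^-1 ^+ n < eps :> R.
    exact: (cvgr_lt _ (@half_vanishing R)).
  by exists N => n Nn; exact: lt_trans (uv n) (hN n Nn).
exists (lim (B (u n) @[n --> \oo])) => eps eps0.
have [N1 hN1] := small _ eps0.
have [|N2 _ hN2] := hilbert_complete (u := B \o u) _ eps0.
  move=> e e0; have [|N hN] := small (e / 2); first by lra.
  exists N => m n /hN hm /hN hn; rewrite /= -SBB (le_lt_trans (nrm_tri _ v _))//.
  by rewrite nrm_distC; lra.
exists (u (maxn N1 N2)); split; first exact: hN1 (leq_maxl _ _).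
exact: hN2 (leq_maxr _ _).
Qed.

Lemma approx_graph_linear a v v' w w' : approx_graph v w -> approx_graph v' w' ->
  approx_graph (a *: v + v') (a *: w + w').
Proof.
move=> vw vw' eps eps0.
have a0 : 0 < 1 + cabs a by rewrite ltr_wpDr ?cabs_ge0.
have [|u [vu wu]] := vw (eps / 2 / (1 + cabs a)); first by rewrite !divr_gt0.
have [|u' [vu' wu']] := vw' (eps / 2); first by rewrite divr_gt0.
have e (H : hilbertSpace R) (F : Z -> H) (x x' : H) : linear F ->
    nrm (x - F u) < eps / 2 / (1 + cabs a) -> nrm (x' - F u') < eps / 2 ->
    nrm (a *: x + x' - F (a *: u + u')) < eps.
  move=> Flin; rewrite ltr_pdivlMr// => h h'.
  rewrite Flin opprD addrACA -scalerBr (le_lt_trans (nrmD _ _))// nrmZ.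
  by have := nrm_ge0 (x - F u); nra.
by exists (a *: u + u'); split; apply: e.
Qed.

Lemma approx_graph_norm v w : approx_graph v w -> nrm v = nrm w.
Proof.
move=> vw; apply/eqP; rewrite eq_le; apply/andP; split; apply/ler_addgt0Pl => e e0;
  have [|u [vu wu]] := vw (e / 2); try lra.
- by have := nrm_tri v (S u) 0; have := nrm_tri (B u) w 0;
    rewrite !subr0 SB (nrm_distC (B u)); lra.
- by have := nrm_tri w (B u) 0; have := nrm_tri (S u) v 0;
    rewrite !subr0 SB (nrm_distC (S u)); lra.
Qed.

Lemma approx_graph_uniq v w w' : approx_graph v w -> approx_graph v w' -> w = w'.
Proof.
move=> vw vw'; have := approx_graph_norm (approx_graph_linear (-1) vw vw').
rewrite !scaleN1r addNr nrm0 addrC => /esym h; apply/esym/eqP.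
by rewrite -subr_eq0; apply/eqP/nrm_eq0; rewrite h.
Qed.

End UnitaryExtension.

(** The closure of the relation between S u and B u is linear and isometric; the
    density of the two ranges makes it total in both directions, hence the graph
    of a unitary. *)
Lemma unitary_extension (R : realType) (Z V W : hilbertSpace R)
    (S : Z -> V) (B : Z -> W) :
  linear S -> linear B -> (forall u, nrm (S u) = nrm (B u)) ->
  dense_range S -> dense_range B ->
  exists U : {linear V -> W}, unitary_operator U /\ forall u, U (S u) = B u.
Proof.
move=> Slin Blin SB Sd Bd.
have /choice[U UG] v := approx_graphP Slin Blin SB v Sd.
have Ulin : linear U.
  move=> a u v; apply: (approx_graph_uniq Slin Blin SB (UG _)).
  exact: approx_graph_linear.
have Unrm v : `|U v| = `|v|.
  by rewrite !nrmE (approx_graph_norm SB (UG v)).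
pose L : {linear V -> W} := HB.pack U (GRing.isLinear.Build _ _ _ _ U Ulin).
exists L; split.
  split=> [u v|].
    have LE x : L x = U x by [].
    by rewrite polarization -linearZ -!linearD !LE !Unrm -polarization.
  apply/seteqP; split=> // w _.
  have [v vw] := approx_graphP Blin Slin (fun u => esym (SB u)) w Bd.
  exists v => //=; apply: (approx_graph_uniq Slin Blin SB (UG v)) => eps /vw[u []].
  by exists u.
move=> u; apply: (approx_graph_uniq Slin Blin SB (UG _)) => eps eps0.
by exists u; rewrite !subrr !nrm0.
Qed.

(** * Sections of a continuous field *)

Lemma dense_near (R : realType) (V : hilbertSpace R) (A : set V) (v : V) (eps : R) :
  dense A -> 0 < eps -> exists2 a, A a & nrm (v - a) < eps.
Proof.
move=> /(_ (ball v eps%:C%C)) dA eps0.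
have [||a []] := dA.
- by exists v; apply: ballxx; rewrite (_ : 0 = 0%:C%C)// ltcR.
- exact: ball_open.
by rewrite -ball_normE /ball_/= nrmE ltcR => va Aa; exists a.
Qed.

Section ComplexContinuity.
Variables (R : realType) (X : topologicalType).
Implicit Types a b : X -> R[i].

Lemma ccontinuousP a : continuous (a : X -> R[i]^o) <->
  forall x0 (eps : R), 0 < eps -> \forall x \near x0, cabs (a x0 - a x) < eps.
Proof.
split=> ac x0.
  move=> eps eps0; have /cvgrPdist_lt/(_ eps%:C%C) := ac x0.
  rewrite (_ : 0 = 0%:C%C)// ltcR => /(_ eps0).
  by apply: filterS => x /=; rewrite cabsE ltcR.
apply/cvgrPdist_lt => e e0; have er := ReC (ltW e0).
move: er e0; set r := complex.Re e => ->; rewrite (_ : 0 = 0%:C%C)// ltcR => r0.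
by have := ac x0 _ r0; apply: filterS => x; rewrite /= -ltcR -cabsE.
Qed.

Lemma continuous_conj a : continuous (a : X -> R[i]^o) ->
  continuous ((fun x => (a x)^*) : X -> R[i]^o).
Proof.
move=> /ccontinuousP ac; apply/ccontinuousP => x0 eps /(ac x0).
by apply: filterS => x; rewrite -rmorphB cabs_conj.
Qed.

End ComplexContinuity.

Section Sections.
Variables (R : realType) (X : topologicalType) (H : continuousField R X).
Implicit Types (e f : forall x, H x).

Lemma csection_sum (I : Type) (r : seq I) (e : I -> forall x, H x) :
  (forall i, csection H (e i)) -> csection H (fun x => \sum_(i <- r) e i x).
Proof.
move=> es; elim: r => [|i r IH].
  have -> : (fun x => \sum_(i <- [::]) e i x) = (fun x => 0 : H x).
    by apply: functional_extensionality_dep => x; rewrite big_nil.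
  exact: csection0.
have -> : (fun x => \sum_(j <- i :: r) e j x) =
    (fun x => e i x + \sum_(j <- r) e j x).
  by apply: functional_extensionality_dep => x; rewrite big_cons.
exact: csectionD.
Qed.

Lemma csectionB e f : csection H e -> csection H f -> csection H (fun x => e x - f x).
Proof.
move=> es fs; have -> : (fun x => e x - f x) = (fun x => e x + (-1) *: f x).
  by apply: functional_extensionality_dep => x; rewrite scaleN1r.
by apply: csectionD => //; apply: csectionZ.
Qed.

Lemma csection_norm_near e x0 (M : R) : csection H e -> nrm (e x0) < M ->
  \forall x \near x0, nrm (e x) < M.
Proof.
move=> es eM; have /ccontinuousP/(_ x0 (M - nrm (e x0))) := csection_norm_continuous es.
rewrite subr_gt0 => /(_ eM); apply: filterS => x.
rewrite !nrmE -rmorphB cabsR ltr_norml; lra.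
Qed.

Lemma csection_approx e :
  (forall (x0 : X) (eps : R), 0 < eps -> exists2 f, csection H f &
     \forall x \near x0, nrm (e x - f x) <= eps) -> csection H e.
Proof.
move=> eH; apply: csection_local => x0 eps eps0; have er := ReC (ltW eps0).
move: er eps0; set r := complex.Re eps => ->; rewrite (_ : 0 = 0%:C%C)// ltcR => r0.
have [f fs ef] := eH x0 r r0; exists f => //.
by apply: filterS ef => x; rewrite nrmE lecR.
Qed.

Lemma csection_limit (e : forall x, H x) (u : nat -> forall x, H x) (d : nat -> R) :
  (forall n, csection H (u n)) -> d @ \oo --> 0 ->
  (forall x0 : X, exists2 M : R, 0 < M &
     \forall x \near x0, forall n, nrm (e x - u n x) <= M * d n) ->
  csection H e.
Proof.
move=> us d0 eu; apply: csection_approx => x0 eps eps0; have [M M0 near_eu] := eu x0.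
have [N _ hN] : \forall n \near \oo, d n < eps / M.
  by apply: (cvgr_lt _ d0); rewrite divr_gt0.
exists (u N) => //; apply: filterS near_eu => x /(_ N)/le_trans->//.
by rewrite mulrC -ler_pdivlMr// ltW//; exact: hN (leqnn N).
Qed.

Lemma csection_scale (a : X -> R[i]) e : continuous (a : X -> R[i]^o) ->
  csection H e -> csection H (fun x => a x *: e x).
Proof.
move=> /ccontinuousP ac es; apply: csection_approx => x0 eps eps0.
pose M := nrm (e x0) + 1; have M0 : 0 < M by rewrite ltr_wpDl ?nrm_ge0.
exists (fun x => a x0 *: e x); first exact: csectionZ.
have eM : \forall x \near x0, nrm (e x) < M.
  by apply: csection_norm_near; rewrite ?ltrDl.
have aM : \forall x \near x0, cabs (a x0 - a x) < eps / M.
  by apply: ac; rewrite divr_gt0.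
apply: filterS2 aM eM => x; rewrite ltr_pdivlMr// => ax ex.
rewrite -scalerBl nrmZ -cabsN opprB.
have := cabs_ge0 (a x0 - a x); have := nrm_ge0 (e x); nra.
Qed.

(** By polarization, since |e + a f| is continuous for every scalar a. *)
Lemma csection_dot e f : csection H e -> csection H f ->
  continuous ((fun x => '[e x, f x]) : X -> R[i]^o).
Proof.
move=> es fs.
have sq g : csection H g -> continuous ((fun x => `|g x| ^+ 2) : X -> R[i]^o).
  move=> /csection_norm_continuous gc x.
  by have := cvgM (gc x) (gc x); apply.
have -> : ((fun x => '[e x, f x]) : X -> R[i]^o) = (fun x =>
    2^-1 * ((`|e x + f x| ^+ 2 - `|e x| ^+ 2 - `|f x| ^+ 2) +
     'i * (`|e x + 'i *: f x| ^+ 2 - `|e x| ^+ 2 - `|f x| ^+ 2))).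
  by apply: funext => x; exact: polarization.
have c1 := sq _ (csectionD es fs).
have c2 := sq _ (csectionD es (csectionZ 'i fs)).
have c3 := sq _ es; have c4 := sq _ fs.
move=> x; apply: cvgM; first exact: cvg_cst.
apply: cvgD; first by apply: cvgB (c4 x); apply: cvgB (c3 x); exact: c1.
apply: cvgM; first exact: cvg_cst.
by apply: cvgB (c4 x); apply: cvgB (c3 x); exact: c2.
Qed.

Lemma csection_point x (v : H x) (eps : R) : 0 < eps ->
  exists2 e, csection H e & nrm (v - e x) < eps.
Proof.
by move=> /(dense_near v (@csection_dense _ _ H x))[_ [e es <-] ve]; exists e.
Qed.

(** Continuity is imposed on the products (v, c n) rather than on c n, so as to
    cover c n = T e_n for a weakly continuous T. *)
Lemma csection_dsum (G : X -> hilbertSpace R) (c : nat -> forall x, G x)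
    (b : nat -> forall x, H x) (v : forall x, G x) (C : X -> R) :
  (forall n, csection H (b n)) ->
  (forall n, continuous ((fun x => '[v x, c n x]) : X -> R[i]^o)) ->
  (forall n x, nrm (c n x) * nrm (b n x) <= C x) ->
  (forall x0 : X, exists2 M : R, 0 < M &
     \forall x \near x0, C x * nrm (v x) <= M) ->
  csection H (fun x => dsum (c^~ x) (b^~ x) (v x)).
Proof.
move=> bs vc cb vM.
apply: (@csection_limit _ (fun n x => psum (c^~ x) (b^~ x) n (v x))
  (fun n => 2^-1 ^+ n)).
- move=> n; apply: csection_sum => i; apply: csection_scale => // x.
  by apply: cvgM (vc i x); exact: cvg_cst.
- exact: half_vanishing.
- move=> x0; have [M M0 near_M] := vM x0; exists M => //.
  apply: filterS near_M => x xM n.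
  rewrite (le_trans (dsum_approx _ (fun i => cb i x) n))//.
  by rewrite ler_wpM2r// exprn_ge0// invr_ge0.
Qed.

End Sections.

(** Every vector of a fibre is close to the value of a section, and the contraction
    M x0 does not enlarge the error. *)
Lemma dense_range_csection (R : realType) (X : topologicalType)
    (H H' : continuousField R X) (M : forall x, H x -> H' x) x0 (w : H' x0) (eps : R) :
  linear (M x0) -> contractive (M x0) -> dense_range (M x0) -> 0 < eps ->
  exists2 s, csection H s & nrm (w - M x0 (s x0)) < eps.
Proof.
move=> Mlin Mc Md eps0; have [|v wv] := Md w (eps / 2); first by rewrite divr_gt0.
have [|s ss vs] := csection_point v (eps := eps / 2); first by rewrite divr_gt0.
exists s => //; rewrite (le_lt_trans (nrm_tri _ (M x0 v) _))//.
have := Mc (v - s x0).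
have -> : M x0 (v - s x0) = M x0 v - M x0 (s x0).
  by have := Mlin (-1) (s x0) v; rewrite !scaleN1r [- s x0 + v]addrC
    [- M x0 _ + _]addrC.
by lra.
Qed.

(** * Smoothing an injective operator with dense range *)

Section Injectivity.
Variables (R : realType) (V : hilbertSpace R).

Definition separating (e : nat -> V) := forall v, (forall n, '[v, e n] = 0) -> v = 0.

Lemma total_separating (e : nat -> V) :
  total_set [set e n | n in [set: nat]] -> separating e.
Proof.
move=> te v ve; apply/nrm_eq0/ler_addgt0Pl => eps eps0; rewrite addr0.
have [_ [n [c [w [we ->]]]] vw] := dense_near v te eps0.
set a := \sum_(_ < _) _ in vw.
have va : '[v, a] = 0.
  rewrite /a; elim/big_rec: _ => [|i y _ IH]; first exact: dot0r.
  by have [k _ <-] := we i; rewrite dotDr dotZr ve mulr0 add0r.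
have [v0|v0] := leP (nrm v) 0; first by rewrite (le_trans v0)// ltW.
rewrite -(ler_pM2l v0) -expr2 (le_trans _ (ler_wpM2l (nrm_ge0 _) (ltW vw)))//.
apply: le_trans (CS v (v - a)).
by rewrite dotBr va subr0 nrm2 cabsR ger0_norm// sqr_ge0.
Qed.

(** Pairing the sum with v itself gives a series of nonnegative multiples of
    |(v, e i)|^2. *)
Lemma dsum_separating (c b e : nat -> V) (lam : nat -> R) (C : R) v :
  (forall i, nrm (c i) * nrm (b i) <= C) ->
  (forall i, 0 < lam i) ->
  (forall i, '[v, c i] * '[b i, v] = (lam i)%:C%C * `|'[v, e i]| ^+ 2) ->
  separating e -> dsum c b v = 0 -> v = 0.
Proof.
move=> cb lam0 cbe esep dv0; apply: esep => i.
have lam0C j : 0 < (lam j)%:C%C :> R[i] by rewrite (_ : 0 = 0%:C%C)// ltcR.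
have pos j : 0 <= '[v, c j] * '[b j, v].
  by rewrite cbe mulr_ge0 ?exprn_ge0// ltW.
have /(_ i)/eqP := dsum_pos cb pos (etrans (congr1 (fun u => '[u, v]) dv0) (dot0l _)).
by rewrite cbe mulf_eq0 gt_eqF//= sqrf_eq0 normr_eq0 => /eqP.
Qed.

End Injectivity.

Section Smoothing.
Variables (R : realType) (V W : hilbertSpace R) (T : {linear V -> W}) (K : R).
Variables (e : nat -> V) (f : nat -> W) (lam : nat -> R).
Hypothesis K0 : 0 <= K.
Hypothesis TK : forall v, nrm (T v) <= K * nrm v.
Hypothesis e1 : forall n, nrm (e n) <= 1.
Hypothesis f1 : forall n, nrm (f n) <= 1.
Hypothesis esep : separating e.
Hypothesis fsep : separating f.
Hypothesis lam01 : forall n, 0 < lam n <= 1.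
Hypothesis Tinj : injective T.
Hypothesis Tdense : dense_range T.

Let g n := (lam n)%:C%C *: dsum (fun i => T (e i)) e (f n).
Hypothesis g1 : forall n, nrm (g n) <= 1.

Let ee i : nrm (e i) * nrm (e i) <= 1.
Proof. by rewrite mulr_ile1// nrm_ge0. Qed.

Let eTe i : nrm (e i) * nrm (T (e i)) <= K.
Proof. 
by rewrite -[leRHS]mul1r ler_pM ?nrm_ge0// (le_trans (TK _))// -[leRHS]mulr1
  ler_wpM2l.
Qed.

Let D := dsum e e.

Let DD : adjoint D D. Proof. exact: dsum_adjoint ee. Qed.

Let D_inj v : D v = 0 -> v = 0.
Proof.
apply: (@dsum_separating _ _ _ _ e (fun=> 1) 1) => // i.
by rewrite mul1r (dotC (e i)) -normCK.
Qed.

Let TD_dense : dense_range (T \o D).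
Proof.
move=> w eps eps0; have [|v wv] := Tdense w (eps := eps / 2); first by lra.
have Dc : contractive D by move=> u; have := dsum_bound u ee; rewrite mul1r.
have [|u vu] := adjoint_dense DD Dc Dc D_inj v (eps := eps / 2 / (1 + K)).
  by rewrite !divr_gt0// ltr_wpDr.
exists u; rewrite /= (le_lt_trans (nrm_tri _ (T v) _))// -linearB.
have := TK (v - D u); move: vu; rewrite ltr_pdivlMr ?ltr_wpDr//.
have := nrm_ge0 (v - D u); nra.
Qed.

Let dot_g v i : '[v, g i] = (lam i)%:C%C * '[T (D v), f i].
Proof.
rewrite /g dotZr -(dsum_adjoint eTe) /D (dsum_map ee v K0 TK); congr (_ * _).
by apply: conj_Creal; apply/complex_realP; exists (lam i).
Qed.

Let lf i : nrm ((lam i)%:C%C *: f i) * nrm (f i) <= 1.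
Proof.
have /andP[l0 l1] := lam01 i.
have ff : nrm (f i) * nrm (f i) <= 1 by rewrite mulr_ile1 ?nrm_ge0.
by rewrite nrmZ cabsR gtr0_norm// -mulrA mulr_ile1 ?mulr_ge0 ?nrm_ge0 ?(ltW l0).
Qed.

Let B_factor v : dsum g f v = dsum (fun i => (lam i)%:C%C *: f i) f (T (D v)).
Proof.
rewrite /dsum; congr (lim (_ @ \oo)); apply: funext => n; apply: eq_bigr => i _.
rewrite dot_g dotZr; congr (_ * (_ * _) *: _).
by apply/esym/conj_Creal/complex_realP; exists (lam i).
Qed.

(** Moving T across the sums gives dsum g f = E T D, where D = dsum e e and E is
    the sum over f with weights lam; each of the three factors is injective. *)
Lemma smoothing_inj v : dsum g f v = 0 -> v = 0.
Proof.
rewrite B_factor => h; apply: D_inj; apply: Tinj; rewrite linear0.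
apply: (dsum_separating (lam := lam) (e := f) lf) h => // i.
  by have /andP[] := lam01 i.
rewrite dotZr (dotC (f i)) -mulrA -normCK; congr (_ * _).
by apply: conj_Creal; apply/complex_realP; exists (lam i).
Qed.

(** If the adjoint of E T D kills w, then the adjoint of E sends w to a vector
    orthogonal to the dense range of T D, hence to 0. *)
Lemma smoothing_adjoint_inj w : dsum f g w = 0 -> w = 0.
Proof.
move=> h.
have gf i : nrm (g i) * nrm (f i) <= 1 by rewrite mulr_ile1 ?nrm_ge0.
have fl i : nrm (f i) * nrm ((lam i)%:C%C *: f i) <= 1 by rewrite mulrC.
have h0 v : '[T (D v), dsum f (fun i => (lam i)%:C%C *: f i) w] = 0.
  by rewrite -(dsum_adjoint lf) -B_factor (dsum_adjoint gf) h dot0r.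
set y := dsum f _ w in h0.
have y0 : y = 0.
  apply/nrm_eq0/ler_addgt0Pl => eps eps0; rewrite addr0.
  have [v yv] := TD_dense y eps0.
  have [y0|y0] := leP (nrm y) 0; first by rewrite (le_trans y0)// ltW.
  rewrite -(ler_pM2l y0) -expr2 [leRHS]mulrC.
  rewrite (le_trans _ (ler_wpM2r (nrm_ge0 y) (ltW yv)))//.
  apply: le_trans (CS _ _).
  by rewrite dotBl [X in _ - X]h0 subr0 nrm2 cabsR ger0_norm// sqr_ge0.
apply: (dsum_separating (lam := lam) (e := f) fl) y0 => // i.
  by have /andP[] := lam01 i.
by rewrite dotZl (dotC (f i)) mulrCA -normCK.
Qed.

End Smoothing.

Section OperatorNorm.
Variables (R : realType) (V W : hilbertSpace R) (T : {linear V -> W}).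
Hypothesis Tb : bounded_operator T.

Lemma opnorm_ub v : nrm v <= 1 -> nrm (T v) <= opnorm T.
Proof.
move=> v1; apply: ub_le_sup; last first.
  by exists v => //=; rewrite nrmE -(lecR _ 1) in v1 *.
have [M _ MT] := ex_strict_bound_gt0 Tb.
exists (complex.Re M) => _ [u /= u1 <-]; have := MT u u1.
by rewrite /= nrmE ltcE => /andP[_] /ltW.
Qed.

Lemma opnorm_ge0 : 0 <= opnorm T.
Proof.
by rewrite (le_trans (nrm_ge0 (T 0)))// opnorm_ub// nrm0.
Qed.

Lemma opnorm_bound v : nrm (T v) <= opnorm T * nrm v.
Proof.
have [v0|v0] := leP (nrm v) 0.
  by rewrite (nrm_eq0 v0) linear0 !nrm0 mulr0.
have inv0 : 0 <= (nrm v)^-1 by rewrite invr_ge0 ltW.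
have := @opnorm_ub ((nrm v)^-1%:C%C *: v).
rewrite linearZ/= !nrmZ cabsR ger0_norm// mulVf ?gt_eqF// => /(_ (lexx _)).
by rewrite mulrC ler_pdivrMr.
Qed.

End OperatorNorm.

(** * Normalized separating sequences of sections *)

Section FieldConstructions.
Variables (R : realType) (X : topologicalType).

Definition unitizer (H : continuousField R X) (e : forall x, H x) (x : X) : R :=
  (1 + nrm (e x))^-1.

(** Dividing by 1 + |e| instead of |e| leaves the zeros of e harmless. *)
Definition unitize (H : continuousField R X) (e : forall x, H x) (x : X) : H x :=
  (unitizer e x)%:C%C *: e x.

Variable H : continuousField R X.
Implicit Types e : forall x, H x.

Lemma unitizer01 e x : 0 < unitizer e x <= 1.
Proof.
have n0 := nrm_ge0 (e x); have n1 : 0 < 1 + nrm (e x) by lra.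
by rewrite invr_gt0 n1 invf_le1// lerDl.
Qed.

Lemma unitize_norm e x : nrm (unitize e x) <= 1.
Proof.
have n0 := nrm_ge0 (e x); have n1 : 0 < 1 + nrm (e x) by lra.
have /andP[u0 _] := unitizer01 e x.
by rewrite nrmZ cabsR gtr0_norm// /unitizer mulrC ler_pdivrMr// mul1r lerDr.
Qed.

Lemma csection_unitize e : csection H e -> csection H (unitize e).
Proof.
move=> es; apply: csection_scale => //.
have -> : (fun x => (unitizer e x)%:C%C) = (fun x => (1 + `|e x|)^-1).
  by apply: funext => x; rewrite fmorphV rmorphD/= -nrmE rmorph1.
move=> x; apply: cvgV; first by rewrite gt_eqF// ltr_wpDr.
by apply: cvgD; [exact: cvg_cst|exact: csection_norm_continuous es x].
Qed.

Lemma separable_unitized : separable_field H ->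
  exists e : nat -> forall x, H x, [/\ forall n, csection H (e n),
    forall n x, nrm (e n x) <= 1 & forall x, separating (e^~ x)].
Proof.
move=> [e [es et]]; exists (fun n => unitize (e n)); split.
- by move=> n; exact: csection_unitize.
- by move=> n x; exact: unitize_norm.
- move=> x v ve; apply: (total_separating (et x)) => n.
  have /andP[u0 _] := unitizer01 (e n) x.
  have /eqP := ve n; rewrite dotZr mulf_eq0 conjC_eq0 => /orP[/eqP h|/eqP//].
  by move: u0; rewrite (complexI h) ltxx.
Qed.

End FieldConstructions.

(** * Polar decomposition over a field *)

Section Polar.
Variables (R : realType) (X : topologicalType) (H1 H2 : continuousField R X).
Unset Implicit Arguments.
Variables (B : forall x, H1 x -> H2 x) (B' : forall x, H2 x -> H1 x).
Hypothesis BB' : forall x, adjoint (B x) (B' x).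
Hypothesis Bc : forall x, contractive (B x).
Hypothesis B'c : forall x, contractive (B' x).
Hypothesis Binj : forall x v, B x v = 0 -> v = 0.
Hypothesis B'inj : forall x w, B' x w = 0 -> w = 0.
Hypothesis Bs : forall e, csection H1 e -> csection H2 (fun x => B x (e x)).
Hypothesis B's : forall f, csection H2 f -> csection H1 (fun x => B' x (f x)).
Set Implicit Arguments.

Let Q x (v : H1 x) := v - B' x (B x v).

Let Qc x : contractive (@Q x).
Proof.
move=> v; have := defect_norm v (BB' x) (B'c x); rewrite -/(Q v).
have := sqr_ge0 (nrm (B x v)) => B0 Qv.
rewrite -(@ler_pXn2r _ 2)// ?nnegrE ?nrm_ge0//; lra.
Qed.

Let QQ x : adjoint (@Q x) (@Q x).
Proof.
by move=> v w; rewrite /Q dotBl dotBr (adjointC (BB' x)) (BB' x).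
Qed.

(** The operator (B' B)^(1/2). *)
Definition modulus x (v : H1 x) : H1 x := sqroot (@Q x) v.

Let modulus_adjoint x : adjoint (@modulus x) (@modulus x).
Proof. exact: sqroot_adjoint. Qed.

Let modulus_sqr x v : modulus (modulus v) = B' x (B x v).
Proof. by rewrite /modulus sqroot_sqr// /Q opprB addrC subrK. Qed.

Let modulus_norm x v : nrm (modulus v) = nrm (B x v).
Proof.
apply/eqP; rewrite -(@eqrXn2 _ 2) ?nrm_ge0//; apply/eqP/complexI.
by rewrite -!nrm2 modulus_adjoint modulus_sqr BB'.
Qed.

Let B_dense x : dense_range (B x).
Proof. exact: adjoint_dense (BB' x) (Bc x) (B'c x) (B'inj x). Qed.

Let modulus_dense x : dense_range (@modulus x).
Proof.
move=> v eps eps0.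
have PP : adjoint (B' x \o B x) (B' x \o B x).
  by move=> u w; rewrite /= (adjointC (BB' x)) BB'.
have Pc : contractive (B' x \o B x) by move=> u; exact: le_trans (B'c _ _) (Bc _ _).
have P0 u : (B' x \o B x) u = 0 -> u = 0 by move=> /B'inj/Binj.
have [u vu] := adjoint_dense PP Pc Pc P0 v eps0.
by exists (modulus u); rewrite modulus_sqr.
Qed.

(** The iterates are built from B, B' and linear combinations, and they converge
    at the rate slack k times |e x|, where |e x| is locally bounded. *)
Let csection_modulus e : csection H1 e -> csection H1 (fun x => modulus (e x)).
Proof.
move=> es; pose u k x := root_iter (@Q x) k (e x).
have us k : csection H1 (u k).
  have gen (g : forall x, H1 x) : csection H1 g ->
      csection H1 (fun x => root_iter (@Q x) k (g x)).
    elim: k g => [g _|k IH g gs]; first exact: csection0.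
    apply: csectionZ; apply: csectionD; last by apply: (IH); exact: IH.
    by apply: csectionB => //; apply: B's; exact: Bs.
  exact: gen.
have Ls : csection H1 (fun x => e x - modulus (e x)).
  apply: (csection_limit us (@slack_vanishing R)) => x0.
  exists (nrm (e x0) + 1); first by rewrite ltr_wpDl ?nrm_ge0.
  have : \forall x \near x0, nrm (e x) < nrm (e x0) + 1.
    by apply: csection_norm_near; rewrite ?ltrDl.
  apply: filterS => x ex k.
  rewrite (le_trans (sqroot_approx (@Qc x) (@QQ x) k (e x)))//.
  by have /andP[s0 _] := slack01 R k; rewrite ler_wpM2r// ltW.
have -> : (fun x => modulus (e x)) = (fun x => e x - (e x - modulus (e x))).
  by apply: functional_extensionality_dep => x; rewrite subKr.
exact: csectionB.
Qed.

(** Fibrewise, U extends S u |-> B u.  If a section e of H1 is close to S s at x0,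
    it remains so near x0 because the norm of the section e - S s is continuous;
    there U e is equally close to the section B s.  A section of H2 is compared
    with B s in the same way, and its preimage with S s. *)
Lemma polar_isomorphism : isomorphic_fields H1 H2.
Proof.
have HU x : exists U : {linear H1 x -> H2 x},
    unitary_operator U /\ forall u, U (modulus u) = B x u.
  exact: (unitary_extension (adjoint_linear (@modulus_adjoint x))
    (adjoint_linear (BB' x)) (@modulus_norm x) (@modulus_dense x) (@B_dense x)).
pose U x := projT1 (cid (HU x)).
have Uu x : unitary_operator (U x) by rewrite /U; case: cid => ? [].
have UB x u : U x (modulus u) = B x u by rewrite /U; case: cid => ? [].
have Unrm x v : nrm (U x v) = nrm v.
  apply/eqP; rewrite -(@eqrXn2 _ 2) ?nrm_ge0//; apply/eqP/complexI.
  by rewrite -!nrm2 (Uu x).1.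
have Udist x v s : nrm (U x v - B x s) = nrm (v - modulus s).
  by rewrite -UB -linearB Unrm.
exists U; split => //; apply/seteqP; split=> [_ [e es <-]|f fs] /=.
- apply: csection_approx => x0 eps eps0.
  have [|s ss e0s] := dense_range_csection (M := modulus) (e x0)
      (adjoint_linear (@modulus_adjoint x0)) _ (@modulus_dense x0) eps0.
  + by move=> v; rewrite modulus_norm; exact: Bc.
  exists (fun x => B x (s x)); first exact: Bs.
  have := csection_norm_near (csectionB es (csection_modulus ss)) e0s.
  by apply: filterS => x /ltW; rewrite Udist.
- have Usurj x : exists v, U x v = f x.
    by have [_ /seteqP[_ /(_ (f x))]] := Uu x; case=> // v _ <-; exists v.
  pose e x := projT1 (cid (Usurj x)).
  have ef x : U x (e x) = f x by rewrite /e; case: cid.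
  exists e; last by apply: functional_extensionality_dep.
  apply: csection_approx => x0 eps eps0.
  have [s ss f0s] := dense_range_csection (f x0)
      (adjoint_linear (BB' x0)) (Bc x0) (@B_dense x0) eps0.
  exists (fun x => modulus (s x)); first exact: csection_modulus.
  have := csection_norm_near (csectionB fs (Bs _ ss)) f0s.
  by apply: filterS => x /ltW; rewrite -ef Udist.
Qed.

End Polar.

(** * The isomorphism *)

Theorem mainTheorem9 (R : realType) (X : topologicalType)
    (H1 H2 : continuousField R X) (T : forall x : X, {linear H1 x -> H2 x}) :
  separable_field H1 -> separable_field H2 ->
  Qmap T ->
  (forall x : X, injective (T x)) ->
  (forall x : X, dense (range (T x))) ->
  isomorphic_fields H1 H2.
Proof.
move=> /separable_unitized[e [es e1 esep]] /separable_unitized[f [fs f1 fsep]].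
move=> [Tb Tlb Tc] Tinj Tdense.
have TK x := opnorm_bound (Tb x).
have K0 x := opnorm_ge0 (Tb x).
have Td x : dense_range (T x).
  by move=> w eps /(dense_near w (Tdense x))[_ [v _ <-] wv]; exists v.
have Tnear (x0 : X) :
    exists2 M : R, 0 < M & \forall x \near x0, opnorm (T x) <= M.
  have [M M0 nearM] := ex_strict_bound_gt0 (Tlb x0 I); exists M => //.
  move: nearM; rewrite /within/=; apply: filterS => x /(_ I)/ltW.
  by apply: le_trans; exact: ler_norm.
pose h m x := dsum (fun i => T x (e i x)) (e^~ x) (f m x).
have hs m : csection H1 (h m).
  apply: (@csection_dsum _ _ H1 H2 (fun i x => T x (e i x)) e (f m)
    (fun x => opnorm (T x))) => //.
  - move=> n; under [X in continuous X]eq_fun do rewrite dotC.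
    by apply: continuous_conj; exact: Tc.
  - move=> n x; rewrite -[leRHS]mulr1 ler_pM ?nrm_ge0// (le_trans (TK x _))//.
    by rewrite -[leRHS]mulr1 ler_wpM2l.
  - move=> x0; have [M M0 nearM] := Tnear x0; exists M => //.
    apply: filterS nearM => x; apply: le_trans.
    by rewrite -[leRHS]mulr1 ler_wpM2l.
pose g m := unitize (h m).
(* Unitizing h, and not only e and f, makes the operators below contractions at
   every point of X; |T x| is only locally bounded. *)
have gs m : csection H1 (g m) by exact: csection_unitize.
have g1 m x : nrm (g m x) <= 1 by exact: unitize_norm.
have gf x i : nrm (g i x) * nrm (f i x) <= 1 by rewrite mulr_ile1 ?nrm_ge0.
have fg x i : nrm (f i x) * nrm (g i x) <= 1 by rewrite mulr_ile1 ?nrm_ge0.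
have near1 (H : continuousField R X) s (x0 : X) : csection H s ->
    exists2 M : R, 0 < M & \forall x \near x0, 1 * nrm (s x) <= M.
  move=> ss; exists (nrm (s x0) + 1); first by rewrite ltr_wpDl ?nrm_ge0.
  have : \forall x \near x0, nrm (s x) < nrm (s x0) + 1.
    by apply: csection_norm_near; rewrite ?ltrDl.
  by apply: filterS => x /ltW; rewrite mul1r.
apply: (@polar_isomorphism _ _ _ _ (fun x => dsum (g^~ x) (f^~ x))
  (fun x => dsum (f^~ x) (g^~ x))).
- by move=> x; exact: dsum_adjoint (gf x).
- by move=> x v; rewrite -[leRHS]mul1r; exact: dsum_bound (gf x).
- by move=> x v; rewrite -[leRHS]mul1r; exact: dsum_bound (fg x).
- move=> x v; exact: (smoothing_inj (K0 x) (TK x) (e1^~ x) (f1^~ x)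
    (esep x) (fsep x) (fun n => unitizer01 (h n) x) (Tinj x)).
- move=> x w; exact: (smoothing_adjoint_inj (K0 x) (TK x) (e1^~ x) (f1^~ x)
    (esep x) (fsep x) (fun n => unitizer01 (h n) x) (Td x) (g1^~ x)).
- move=> s ss; apply: (csection_dsum fs _ _ (C := fun=> 1)) => //.
  + by move=> n; exact: csection_dot.
  + by move=> x0; exact: near1.
- move=> s ss; apply: (csection_dsum gs _ _ (C := fun=> 1)) => //.
  + by move=> n; exact: csection_dot.
  + by move=> x0; exact: near1.
Qed.
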